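(* Let $\mathcal{A}$ be a unital real $C^*$-algebra and $\mathcal{H}$ a real Hilbert space. Let $\phi:\mathcal{A}\to\mathbb{R}$ be a pure real state and let $(\mathcal{K},\pi,z)$ be its minimal GNS representation, where the irreducible representation $\pi$ is of real type. If $\Phi:\mathcal{A}\to\mathscr{B}(\mathcal{H})$, $\Phi(a)=\phi(a)I_{\mathcal{H}}$, is the inflation of $\phi$ on $\mathcal{H}$, then $\Phi\in\mathrm{UCP}_{C^*-ext}(\mathcal{A},\mathscr{B}(\mathcal{H}))$.
   Context: All linear maps are real linear. A real $C^*$-algebra is a real Banach $*$-algebra with $\|a^*a\|=\|a\|^2$ and $1+a^*a$ invertible in the unitization for all $a$. An element is positive if it is of the form $b^*b$. For a real Hilbert space $\mathcal{H}$, $\mathscr{B}(\mathcal{H})$ is the algebra of bounded real linear operators. A real linear $\Phi:\mathcal{A}\to\mathscr{B}(\mathcal{H})$ is completely positive (CP) if $\sum_{i,j=1}^nT_i^*\Phi(a_i^*a_j)T_j\ge0$ for all finite families $a_j\in\mathcal{A}$, $T_j\in\mathscr{B}(\mathcal{H})$. $\mathrm{UCP}(\mathcal{A},\mathscr{B}(\mathcal{H}))$ is the set of CP maps with $\Phi(1)=I$. $\mathrm{Ad}_T(X)=T^*XT$. $\Phi\in\mathrm{UCP}(\mathcal{A},\mathscr{B}(\mathcal{H}))$ is a $C^*$-extreme point (written $\Phi\in\mathrm{UCP}_{C^*-ext}(\mathcal{A},\mathscr{B}(\mathcal{H}))$) if whenever $\Phi=\sum_{j=1}^n\mathrm{Ad}_{T_j}\circ\Phi_j$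 with $\Phi_j\in\mathrm{UCP}(\mathcal{A},\mathscr{B}(\mathcal{H}))$ and invertible $T_j\in\mathscr{B}(\mathcal{H})$ satisfying $\sum_jT_j^*T_j=I$, then for every $j$ there is a unitary $U_j\in\mathscr{B}(\mathcal{H})$ with $\Phi_j=\mathrm{Ad}_{U_j}\circ\Phi$. A real state is a unital positive linear functional $\phi:\mathcal{A}\to\mathbb{R}$ with $\phi(a^* )=\phi(a)$; it is a UCP map into $\mathbb{R}=\mathscr{B}(\mathbb{R})$. A CP map $\Phi:\mathcal{A}\to\mathscr{B}(\mathcal{H})$ is pure if every CP map $\Psi$ for which $\Phi-\Psi$ is CP is of the form $\Psi=t\Phi$ with $t\in[0,1]$. The minimal GNS representation of $\phi$ is $(\mathcal{K},\pi,z)$ with $\mathcal{K}$ a real Hilbert space, $\pi:\mathcal{A}\to\mathscr{B}(\mathcal{K})$ a unital $*$-homomorphism, $z\in\mathcal{K}$ with $\phi(a)=\langle\pi(a)z,z\rangle$ and $\overline{\mathrm{span}}\,\pi(\mathcal{A})z=\mathcal{K}$. For pure $\phi$, $\pi$ is irreducible (no closed invariant subspaces other than $\{0\},\mathcal{K}$); it is of real type if its commutant $\pi(\mathcal{A})'$ is isomorphic to $\mathbb{R}$ (i.e. equals $\mathbb{R}I_{\mathcal{K}}$). *)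

(* Defs.v *)
From HB Require Import structures.
From mathcomp Require Import all_boot all_order all_algebra.
From mathcomp Require Import ring lra.
From mathcomp Require Import boolp classical_sets functions interval_inference reals topology normedtype.

Set Implicit Arguments.
Unset Strict Implicit.
Unset Printing Implicit Defensive.

Import Order.TTheory GRing.Theory Num.Theory.
Import numFieldNormedType.Exports.

Local Open Scope classical_set_scope.
Local Open Scope ring_scope.

HB.mixin Record CompleteNormedModule_isRealHilbert (R : realType) H
    & CompleteNormedModule R H := {
  hdot : H -> H -> R;
  hdotC : forall x y, hdot x y = hdot y x;
  hdot_is_linear : forall y, linear_for *%R (hdot^~ y);
  hdotxx : forall x, hdot x x = `|x| ^+ 2
}.

#[short(type="realHilbertType")]
HB.structure Definition RealHilbert (R : realType) :=
  {H of CompleteNormedModule R H & CompleteNormedModule_isRealHilbert R H}.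

(* Normed modules and algebras have no common join in the library, so the
   norm and its completeness are fields of the structure.
   The isometry of the involution and cnorm 1 = 1 follow from cnorm_starM.
   An algType has 1 != 0, which excludes only the zero algebra; the latter has
   no state. *)
HB.mixin Record Algebra_isRealCstar (R : realType) A & GRing.Algebra R A := {
  cnorm : A -> R;
  cnorm_triangle : forall a b, cnorm (a + b) <= cnorm a + cnorm b;
  cnormZ : forall (c : R) a, cnorm (c *: a) = `|c| * cnorm a;
  cnorm0_eq0 : forall a, cnorm a = 0 -> a = 0;
  cnorm_submul : forall a b, cnorm (a * b) <= cnorm a * cnorm b;
  cnorm_complete : forall u : nat -> A,
    (forall e : R, 0 < e -> exists N, forall m n,
       (N <= m)%N -> (N <= n)%N -> cnorm (u m - u n) < e) ->
    exists l, forall e : R, 0 < e -> exists N, forall n,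
       (N <= n)%N -> cnorm (u n - l) < e;
  star : A -> A;
  star_is_linear : linear star;
  starM : forall a b, star (a * b) = star b * star a;
  starK : involutive star;
  cnorm_starM : forall a, cnorm (star a * a) = cnorm a ^+ 2;
  add1_star_inv : forall a, exists b,
    (1 + star a * a) * b = 1 /\ b * (1 + star a * a) = 1
}.

#[short(type="realCstarAlgType")]
HB.structure Definition RealCstarAlgebra (R : realType) :=
  {A of GRing.Algebra R A & Algebra_isRealCstar R A}.

Section Dot.
Context {R : realType} {H : realHilbertType R}.
Implicit Types x y z : H.

Lemma hdotDl x y z : hdot (x + y) z = hdot x z + hdot y z.
Proof. by have := hdot_is_linear z 1 x y; rewrite scale1r mul1r. Qed.

Lemma hdot0l z : hdot 0 z = 0 :> R.
Proof. by apply: (addrI (hdot 0 z)); rewrite -hdotDl !addr0. Qed.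

Lemma hdotZl c x z : hdot (c *: x) z = c * hdot x z.
Proof. by have := hdot_is_linear z c x 0; rewrite !addr0 hdot0l addr0. Qed.

Lemma hdotDr x y z : hdot z (x + y) = hdot z x + hdot z y.
Proof. by rewrite hdotC hdotDl !(hdotC z). Qed.

Lemma hdotZr c x z : hdot z (c *: x) = c * hdot z x.
Proof. by rewrite hdotC hdotZl (hdotC z). Qed.

Lemma hdot0r z : hdot z 0 = 0 :> R.
Proof. by rewrite hdotC hdot0l. Qed.

Lemma hdotNl x z : hdot (- x) z = - hdot x z.
Proof. by rewrite -scaleN1r hdotZl mulN1r. Qed.

Lemma hdotNr x z : hdot z (- x) = - hdot z x.
Proof. by rewrite hdotC hdotNl (hdotC z). Qed.

Lemma hdot_eq0 x : hdot x x = 0 -> x = 0.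
Proof. by rewrite hdotxx => /eqP; rewrite sqrf_eq0 normr_eq0 => /eqP. Qed.

Lemma hdot_inj x y : (forall z, hdot x z = hdot y z) -> x = y.
Proof.
move=> e; apply/subr0_eq/hdot_eq0.
by rewrite hdotDl hdotNl e subrr.
Qed.

End Dot.

HB.instance Definition _ (R : realType) :=
  CompleteNormedModule_isRealHilbert.Build R R^o
    (fun x y : R => mulrC x y)
    (fun y a x x' => eq_trans (mulrDl (a * x) x' y)
                              (congr1 (+%R^~ (x' * y)) (esym (mulrA a x y))))
    (fun x => esym (real_normK (num_real x))).

Record bop (R : realType) (H : realHilbertType R) := Bop {
  bop_fun :> H -> H;
  bop_linear : linear bop_fun;
  bop_bounded : exists M : R, forall x, `|bop_fun x| <= M * `|x|
}.

HB.instance Definition _ (R : realType) (H : realHilbertType R) :=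
  gen_eqMixin (bop H).
HB.instance Definition _ (R : realType) (H : realHilbertType R) :=
  gen_choiceMixin (bop H).

Section BoundedOperators.
Context {R : realType} {H : realHilbertType R}.
Implicit Types (S T U : bop H) (x y : H) (c : R).

Lemma bopP S T : (forall x, S x = T x) -> S = T.
Proof.
case: S T => [f lf bf] [g lg bg] /= /funext fg; subst g.
by rewrite (Prop_irrelevance lf lg) (Prop_irrelevance bf bg).
Qed.

Lemma bopD T x y : T (x + y) = T x + T y.
Proof. by have := bop_linear T 1 x y; rewrite !scale1r. Qed.

Lemma bop0 T : T 0 = 0.
Proof. by apply: (addrI (T 0)); rewrite -bopD !addr0. Qed.

Lemma bopZ T c x : T (c *: x) = c *: T x.
Proof. by have := bop_linear T c x 0; rewrite bop0 !addr0. Qed.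

Lemma bop_bound T : exists2 M : R, 0 <= M & forall x, `|T x| <= M * `|x|.
Proof.
have [M hM] := bop_bounded T; exists `|M| => // x.
by apply: le_trans (hM x) _; rewrite ler_wpM2r// ler_norm.
Qed.

Let zero_linear : linear (fun _ : H => 0 : H).
Proof. by move=> c x y; rewrite scaler0 addr0. Qed.
Let zero_bounded : exists M : R, forall x : H, `|0 : H| <= M * `|x|.
Proof. by exists 0 => x; rewrite normr0 mul0r. Qed.
Definition bop_zero := Bop zero_linear zero_bounded.

Let id_linear : linear (fun x : H => x).
Proof. by []. Qed.
Let id_bounded : exists M : R, forall x : H, `|x| <= M * `|x|.
Proof. by exists 1 => x; rewrite mul1r. Qed.
Definition bop_one := Bop id_linear id_bounded.

Let opp_linear T : linear (fun x => - T x).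
Proof. by move=> c x y; rewrite bopD bopZ opprD scalerN. Qed.
Let opp_bounded T : exists M : R, forall x, `|- T x| <= M * `|x|.
Proof. by have [M _ hM] := bop_bound T; exists M => x; rewrite normrN. Qed.
Definition bop_opp T := Bop (opp_linear T) (opp_bounded T).

Let add_linear S T : linear (fun x => S x + T x).
Proof. by move=> c x y; rewrite !bopD !bopZ scalerDr addrACA. Qed.
Let add_bounded S T : exists M : R, forall x, `|S x + T x| <= M * `|x|.
Proof.
have [M _ hM] := bop_bound S; have [N _ hN] := bop_bound T.
exists (M + N) => x; rewrite mulrDl.
exact: le_trans (ler_normD _ _) (lerD (hM x) (hN x)).
Qed.
Definition bop_add S T := Bop (add_linear S T) (add_bounded S T).

Let scale_linear c T : linear (fun x => c *: T x).
Proof. by move=> d x y; rewrite bopD bopZ scalerDr !scalerA (mulrC c). Qed.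
Let scale_bounded c T : exists M : R, forall x, `|c *: T x| <= M * `|x|.
Proof.
have [M _ hM] := bop_bound T; exists (`|c| * M) => x.
by rewrite normrZ -mulrA ler_wpM2l.
Qed.
Definition bop_scale c T := Bop (scale_linear c T) (scale_bounded c T).

Let comp_linear S T : linear (fun x => S (T x)).
Proof. by move=> c x y; rewrite !bopD !bopZ. Qed.
Let comp_bounded S T : exists M : R, forall x, `|S (T x)| <= M * `|x|.
Proof.
have [M M0 hM] := bop_bound S; have [N _ hN] := bop_bound T.
exists (M * N) => x; apply: le_trans (hM _) _.
by rewrite -mulrA ler_wpM2l.
Qed.
Definition bop_comp S T := Bop (comp_linear S T) (comp_bounded S T).

Let addA : associative bop_add.
Proof. by move=> S T U; apply: bopP => x /=; rewrite addrA. Qed.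
Let addC : commutative bop_add.
Proof. by move=> S T; apply: bopP => x /=; rewrite addrC. Qed.
Let add0 : left_id bop_zero bop_add.
Proof. by move=> S; apply: bopP => x /=; rewrite add0r. Qed.
Let addN : left_inverse bop_zero bop_opp bop_add.
Proof. by move=> S; apply: bopP => x /=; rewrite addNr. Qed.
HB.instance Definition _ := GRing.isZmodule.Build (bop H) addA addC add0 addN.

Let compA : associative bop_comp.
Proof. by move=> S T U; apply: bopP. Qed.
Let comp1l : left_id bop_one bop_comp.
Proof. by move=> S; apply: bopP. Qed.
Let comp1r : right_id bop_one bop_comp.
Proof. by move=> S; apply: bopP. Qed.
Let compDl : left_distributive bop_comp +%R.
Proof. by move=> S T U; apply: bopP. Qed.
Let compDr : right_distributive bop_comp +%R.
Proof. by move=> S T U; apply: bopP => x /=; rewrite bopD. Qed.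
HB.instance Definition _ := GRing.Zmodule_isPzRing.Build (bop H)
  compA comp1l comp1r compDl compDr.

Let scaleA c d T : bop_scale c (bop_scale d T) = bop_scale (c * d) T.
Proof. by apply: bopP => x /=; rewrite scalerA. Qed.
Let scale1 : left_id 1 bop_scale.
Proof. by move=> T; apply: bopP => x /=; rewrite scale1r. Qed.
Let scaleDr : right_distributive bop_scale +%R.
Proof. by move=> c S T; apply: bopP => x /=; rewrite scalerDr. Qed.
Let scaleDl T : {morph bop_scale^~ T : c d / c + d}.
Proof. by move=> c d; apply: bopP => x /=; rewrite scalerDl. Qed.
HB.instance Definition _ := GRing.Zmodule_isLmodule.Build R (bop H)
  scaleA scale1 scaleDr scaleDl.

Lemma bop_addE S T x : (S + T) x = S x + T x. Proof. by []. Qed.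
Lemma bop_oppE T x : (- T) x = - T x. Proof. by []. Qed.
Lemma bop_zeroE x : (0 : bop H) x = 0. Proof. by []. Qed.
Lemma bop_mulE S T x : (S * T) x = S (T x). Proof. by []. Qed.
Lemma bop_oneE x : (1 : bop H) x = x. Proof. by []. Qed.
Lemma bop_scaleE c T x : (c *: T) x = c *: T x. Proof. by []. Qed.

End BoundedOperators.

Section Adjoint.
Context {R : realType} {H : realHilbertType R}.
Implicit Types (S T : bop H) (x y z : H) (c : R).

Lemma hdot_cauchy_schwarz x y :
  (hdot x y : R) ^+ 2 <= `|x| ^+ 2 * `|y| ^+ 2.
Proof.
have [->|y0] := eqVneq y 0; first by rewrite hdot0r normr0 !expr0n mulr0.
have n0 : 0 < `|y| ^+ 2 by rewrite exprn_gt0// normr_gt0.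
have := sqr_ge0 (`| (`|y| ^+ 2) *: x - hdot x y *: y |).
rewrite -hdotxx !(hdotDl, hdotDr, hdotNl, hdotNr, hdotZl, hdotZr).
rewrite (hdotC y x) !hdotxx => h.
rewrite -subr_ge0 -(pmulr_rge0 _ n0); nra.
Qed.

Lemma hdot_le x y : `|hdot x y : R| <= `|x| * `|y|.
Proof.
rewrite -(@ler_pXn2r _ 2%N)// ?nnegrE ?mulr_ge0 ?normr_ge0//.
by rewrite real_normK ?num_real// exprMn hdot_cauchy_schwarz.
Qed.

Lemma riesz (f : H -> R) :
    linear_for *%R f -> (exists M : R, forall x, `|f x| <= M * `|x|) ->
  exists z, forall x, f x = hdot x z.
Proof.
move=> fl [M hM].
have fD x y : f (x + y) = f x + f y by have := fl 1 x y; rewrite scale1r mul1r.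
have f0 : f 0 = 0 by apply: (addrI (f 0)); rewrite -fD !addr0.
have fZ c x : f (c *: x) = c * f x by have := fl c x 0; rewrite f0 !addr0.
pose q x : R := hdot x x - 2 * f x.
have q_ge x : - M ^+ 2 <= q x.
  rewrite /q hdotxx.
  have := hM x; have := ler_norm (f x); have := sqr_ge0 (`|x| - M).
  by rewrite !expr2; nra.
have qinf : has_inf (range q).
  by split; [exists (q 0), 0 | exists (- M ^+ 2) => _ [x _ <-]].
pose m := inf (range q).
have m_le x : m <= q x by apply: (ge_inf qinf.2); exists x.
have approx n : exists x, q x < m + n.+1%:R^-1.
  have e0 : 0 < n.+1%:R^-1 :> R by rewrite invr_gt0.
  by have [_ [x _ <-] hx] := inf_adherent e0 qinf; exists x.
have {approx} [u hu] := choice approx.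
have close n p : `|u n - u p| ^+ 2 <= 2 * n.+1%:R^-1 + 2 * p.+1%:R^-1.
  have := m_le (2^-1 *: (u n + u p)); have := hu n; have := hu p.
  rewrite /q -hdotxx !(hdotDl, hdotDr, hdotNl, hdotNr, hdotZl, hdotZr, fD, fZ).
  rewrite (hdotC (u p) (u n)); move: (n.+1%:R^-1) (p.+1%:R^-1) => i j.
  move: (hdot _ _) (hdot _ _) (hdot _ _) (f _) (f _) => a b d v w.
  by lra.
have inv_small (e : R) : 0 < e -> exists N, forall n, (N <= n)%N -> n.+1%:R^-1 < e.
  move=> e0; have [N _ hN] := near_infty_natSinv_lt (PosNum e0).
  by exists N => n /hN.
have : cvg (u @ \oo).
  apply/cauchy_cvgP/cauchy_exP => e e0.
  have e40 : 0 < e ^+ 2 / 4 by rewrite divr_gt0// exprn_gt0.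
  have [N hN] := inv_small _ e40.
  exists (u N); exists N => // n /= Nn.
  rewrite -ball_normE /= -(@ltr_pXn2r _ 2%N)// ?nnegrE ?normr_ge0 ?(ltW e0)//.
  apply: le_lt_trans (close _ _) _.
  move: (hN _ Nn) (hN _ (leqnn N)).
  by move: (n.+1%:R^-1) (N.+1%:R^-1) (e ^+ 2) => i j d; lra.
move=> /cvg_ex[z /cvgrPdist_lt uz].
have near_z (e : R) : 0 < e -> exists2 x, q x < m + e & `|z - x| ^+ 2 < e.
  move=> e0; have [N hN] := inv_small e e0.
  have [|N' _ hN'] := uz (Num.sqrt e); first by rewrite sqrtr_gt0.
  exists (u (maxn N N')).
    by apply: lt_trans (hu _) _; rewrite ltrD2l hN// leq_maxl.
  rewrite -[ltRHS](sqr_sqrtr (ltW e0)) ltr_pXn2r// ?nnegrE ?sqrtr_ge0//.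
  by apply: hN' => /=; rewrite leq_maxr.
exists z => h; rewrite hdotC; apply/eqP; rewrite eq_sym -subr_eq0 -sqrf_eq0.
set g := hdot z h - f h; set N : R := hdot h h.
have N0 : 0 <= N by rewrite /N hdotxx sqr_ge0.
rewrite eq_le sqr_ge0 andbT leNgt; apply/negP => g0.
have [|x qx zx] := near_z (g ^+ 2 / (4 * N + 4)).
  by rewrite divr_gt0//; lra.
move: qx zx; set e := g ^+ 2 / _ => qx zx.
have eE : g ^+ 2 = e * (4 * N + 4) by rewrite /e divfK//; apply: lt0r_neq0; lra.
pose gx := hdot x h - f h; pose t := - gx / (N + 1).
have gx_small : gx ^+ 2 <= e * (N + 1).
  have tE : t * (N + 1) = - gx by rewrite /t divfK//; apply: lt0r_neq0; lra.
  have := m_le (x + t *: h); move: qx.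
  rewrite /q !(hdotDl, hdotDr, hdotZl, hdotZr, fD, fZ) (hdotC h x) -/N.
  rewrite -(subrK (f h) (hdot x h)) -/gx => qx hm.
  have t2 : 0 <= 2 * t * gx + t ^+ 2 * (N + 1) + e by nra.
  have : 0 <= (2 * t * gx + t ^+ 2 * (N + 1) + e) * (N + 1) by rewrite mulr_ge0//; lra.
  have -> : (2 * t * gx + t ^+ 2 * (N + 1) + e) * (N + 1) =
      2 * (t * (N + 1)) * gx + (t * (N + 1)) ^+ 2 + e * (N + 1) by ring.
  by rewrite tE; nra.
have := hdot_cauchy_schwarz (z - x) h.
rewrite -(hdotxx h) -/N hdotDl hdotNl.
have -> : hdot z h - hdot x h = g - gx by rewrite /g /gx; ring.
have e0 : 0 < e by rewrite divr_gt0//; lra.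
have zxN : `|z - x| ^+ 2 * N <= e * N by rewrite ler_wpM2r// ltW.
have := sqr_ge0 (g - 2 * gx).
have -> : (g - 2 * gx) ^+ 2 = 2 * gx ^+ 2 + 2 * (g - gx) ^+ 2 - g ^+ 2 by ring.
by move=> ? cs; lra.
Qed.

Lemma adj_exists T :
  {S : bop H | forall x y, hdot (S x) y = hdot x (T y)}.
Proof.
apply: cid; have [M M0 hM] := bop_bound T.
have rep x : exists z, forall y, hdot x (T y) = hdot y z.
  apply: riesz => [c y y'|]; first by rewrite bopD bopZ hdotDr hdotZr.
  exists (`|x| * M) => y; apply: le_trans (hdot_le _ _) _.
  by rewrite -mulrA ler_wpM2l.
have {rep} [S hS] := choice rep.
have SE x y : hdot (S x) y = hdot x (T y) by rewrite hS hdotC.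
have Sl : linear S.
  by move=> c x x'; apply: hdot_inj => y; rewrite hdotDl hdotZl !SE hdotDl hdotZl.
have Sb : exists M : R, forall x, `|S x| <= M * `|x|.
  exists M => x; have [->|Sx0] := eqVneq (S x) 0.
    by rewrite normr0 mulr_ge0.
  have n0 : 0 < `|S x| by rewrite normr_gt0.
  rewrite -(ler_pM2r n0) -expr2 -hdotxx SE.
  apply: le_trans (ler_norm _) (le_trans (hdot_le _ _) _).
  by rewrite (mulrC M) -mulrA ler_wpM2l.
by exists (Bop Sl Sb).
Qed.

Definition adj T : bop H := sval (adj_exists T).

Lemma adjP T x y : hdot (adj T x) y = hdot x (T y).
Proof. exact: svalP (adj_exists T) x y. Qed.

Lemma adj_unique S T : (forall x y, hdot (S x) y = hdot x (T y)) -> S = adj T.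
Proof.
by move=> h; apply: bopP => x; apply: hdot_inj => y; rewrite h adjP.
Qed.

End Adjoint.

Section Maps.
Context {R : realType} {A : realCstarAlgType R}.

Section Operators.
Context {H : realHilbertType R}.
Implicit Types (T U X : bop H) (x y u v : H) (Phi Psi : A -> bop H).

Definition positive_op X := exists S : bop H, X = adj S * S.

Definition invertible_op T := exists S : bop H, T * S = 1 /\ S * T = 1.

Definition unitary_op U := adj U * U = 1 /\ U * adj U = 1.

Definition Ad T X : bop H := adj T * X * T.

Definition CP_positive Phi := forall n (a : 'I_n -> A) (T : 'I_n -> bop H),
  positive_op
    (\sum_(i < n) \sum_(j < n) adj (T i) * Phi (star (a i) * a j) * T j).

Let bop_outer_linear u v : linear (fun x : H => (hdot x u : R) *: v).
Proof. by move=> c x y; rewrite hdotDl hdotZl scalerDl scalerA. Qed.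
Let bop_outer_bounded u v :
  exists M : R, forall x : H, `|(hdot x u : R) *: v| <= M * `|x|.
Proof.
exists (`|u| * `|v|) => x.
by rewrite normrZ mulrAC ler_wpM2r// mulrC hdot_le.
Qed.
Let bop_outer u v : bop H := Bop (bop_outer_linear u v) (bop_outer_bounded u v).

Let positive_op_sym X x y : positive_op X -> hdot (X x) y = hdot (X y) x.
Proof. by case=> S ->; rewrite !bop_mulE !adjP hdotC. Qed.

Lemma CP_positive_adj Phi (u v : H) : u != 0 -> v != 0 -> hdot u v = 0 ->
  CP_positive Phi -> forall a, Phi (star a) = adj (Phi a).
Proof.
move=> u0 v0 uv posPhi a; apply: adj_unique => s t.
have star1 : star 1 = 1 :> A.
  by rewrite -[LHS]mul1r -[X in X * _]starK -starM mul1r starK.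
have sym b T x y :
    hdot (Phi (star b * b) (T x)) (T y) = hdot (Phi (star b * b) (T y)) (T x).
  have := @positive_op_sym _ x y (posPhi 1%N (fun=> b) (fun=> T)).
  by rewrite !big_ord1 !bop_mulE !adjP.
pose T := bop_outer v t; pose S := bop_outer u s.
pose b (i : 'I_2) := if i == ord0 then a else 1.
pose B (i : 'I_2) := if i == ord0 then T else S.
have := positive_op_sym u v (posPhi 2 b B).
rewrite !big_ord_recl !big_ord0 !addr0 !bop_addE !bop_mulE.
rewrite (_ : b ord0 = a)// (_ : B ord0 = T)//.
rewrite (_ : b (lift _ _) = 1)// (_ : B (lift _ _) = S)//.
rewrite !hdotDl !adjP (sym a T u v) star1.
have -> : hdot (Phi (1 * 1) (S u)) (S v) = hdot (Phi (1 * 1) (S v)) (S u).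
  by have := sym 1 S u v; rewrite star1.
have Tu : T u = 0 by rewrite /= uv scale0r.
have Sv : S v = 0 by rewrite /= hdotC uv scale0r.
rewrite Tu Sv !bop0 !hdot0l !hdot0r !addr0 !add0r mulr1 mul1r.
rewrite /= !bopZ !hdotZl !hdotZr !hdotxx => e.
have uv0 : (`|u| ^+ 2) * (`|v| ^+ 2) != 0 by rewrite mulf_neq0// expf_neq0// normr_eq0.
apply: (mulfI uv0); rewrite (hdotC s) -[LHS]mulrA; apply: etrans e _; ring.
Qed.

(* Positive elements S^* S are self-adjoint, so the last clause follows from
   the positivity condition unless dim H = 1 (see CP_positive_adj).  On the
   commutative algebra B(R) every real number is self-adjoint and the condition
   only says Phi (a^* a) >= 0; the clause then is what makes UCP(A, B(R)) the
   set of real states. *)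
Definition CP Phi :=
  [/\ linear Phi, CP_positive Phi & forall a, Phi (star a) = adj (Phi a)].

Definition UCP Phi := CP Phi /\ Phi 1 = 1.

Definition pure Phi := CP Phi /\
  forall Psi, CP Psi -> CP (fun a => Phi a - Psi a) ->
    exists t : R, 0 <= t <= 1 /\ forall a, Psi a = t *: Phi a.

Definition Cstar_extreme Phi := UCP Phi /\
  forall n (T : 'I_n -> bop H) (Phis : 'I_n -> A -> bop H),
    (forall j, UCP (Phis j)) ->
    (forall j, invertible_op (T j)) ->
    \sum_(j < n) adj (T j) * T j = 1 ->
    (forall a, Phi a = \sum_(j < n) Ad (T j) (Phis j a)) ->
    forall j, exists U, unitary_op U /\ forall a, Phis j a = Ad U (Phi a).

End Operators.

Definition inflation (phi : A -> R) (H : realHilbertType R) : A -> bop H :=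
  fun a => phi a *: (1 : bop H).

Definition real_state (phi : A -> R) :=
  [/\ linear_for *%R phi, phi 1 = 1, forall a, 0 <= phi (star a * a)
    & forall a, phi (star a) = phi a].

(* a functional seen as a map into B(R), x acting on R as multiplication *)
Definition pure_functional (phi : A -> R) := pure (inflation phi R^o).

Section Representations.
Context {K : realHilbertType R}.
Implicit Types (pi : A -> bop K) (V : set K).

Definition subspace V :=
  V 0 /\ forall (c : R) x y, V x -> V y -> V (c *: x + y).

Definition lspan (E : set K) : set K :=
  [set x | forall V, subspace V -> E `<=` V -> V x].

Definition unital_star_hom pi :=
  [/\ linear pi, forall a b, pi (a * b) = pi a * pi b, pi 1 = 1
    & forall a, pi (star a) = adj (pi a)].

Definition minimal_GNS (phi : A -> R) pi (z : K) :=
  [/\ unital_star_hom pi, forall a, phi a = hdot (pi a z) z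
    & closure (lspan [set pi a z | a in setT]) = setT].

Definition irreducible pi := forall V,
  closed V -> subspace V -> (forall a x, V x -> V (pi a x)) ->
  V = [set 0] \/ V = setT.

Definition commutant pi : set (bop K) :=
  [set T | forall a, T * pi a = pi a * T].

Definition real_type pi := commutant pi = [set c *: (1 : bop K) | c in setT].

End Representations.
End Maps.

(* Main.v *)
(* If [Phi = sum_j Ad_(T_j) o Phi_j], then for a vector [h] each functional
   [a |-> <Phi_j(a) T_j h, T_j h>] is dominated by [|h|^2 phi].  By the
   Cauchy-Schwarz inequality for completely positive maps, the form
   [(a, b) |-> <Phi_j(b^* a) T_j h, T_j k>] is then bounded by a multiple of
   [|pi(a) z| |pi(b) z|], hence it is [<pi(a) z, S pi(b) z>] for some bounded
   operator [S], which commutes with [pi(A)].  As [pi] is of real type, [S] is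
   scalar; so [<Phi_j(a) T_j h, T_j k> = phi(a) <T_j h, T_j k>], and since [T_j]
   is onto, [Phi_j = Phi] and [U_j = 1].  That [Phi] itself is completely
   positive follows from Schur's product theorem and from the existence of
   square roots of positive operators, by the iteration
   [Y |-> (Z + Y^2) / 2], whose limit [W] satisfies [(1 - W)^2 = 1 - Z]. *)
Require Import Defs.
From mathcomp Require Import all_boot all_order all_algebra.
From mathcomp Require Import boolp classical_sets functions reals topology normedtype.
From mathcomp Require Import ring lra.

Set Implicit Arguments.
Unset Strict Implicit.
Unset Printing Implicit Defensive.

Import Order.TTheory GRing.Theory Num.Theory.
Import numFieldNormedType.Exports.

Local Open Scope classical_set_scope.
Local Open Scope ring_scope.

(** Evaluate at the minimizer [- q / r]. If [r = 0], a nonzero [q] would let the affine function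
    take the value [-1]. *)
Lemma discriminant_le0 (R : realFieldType) (p q r : R) :
  0 <= r -> (forall t, 0 <= p + 2 * t * q + t ^+ 2 * r) -> q ^+ 2 <= p * r.
Proof.
rewrite le_eqVlt => /predU1P[<-|r0] h.
  have [->|q0] := eqVneq q 0; first by rewrite expr0n mulr0.
  have := h (- (p + 1) / (2 * q)).
  have -> : p + 2 * (- (p + 1) / (2 * q)) * q + (- (p + 1) / (2 * q)) ^+ 2 * 0 = - 1.
    by field; rewrite q0.
  by lra.
have := h (- q / r).
have -> : p + 2 * (- q / r) * q + (- q / r) ^+ 2 * r = (p * r - q ^+ 2) / r.
  by field; rewrite gt_eqF.
by rewrite pmulr_lge0 ?invr_gt0// subr_ge0.
Qed.

(** * Positive operators and their quadratic forms *)

Section Operators.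
Context {R : realType} {H : realHilbertType R}.
Implicit Types (S T U X Y Z : bop H) (x y : H).

Lemma hdot_ge0 x : 0 <= hdot x x :> R.
Proof. by rewrite hdotxx sqr_ge0. Qed.

Lemma hdot_suml n (f : 'I_n -> H) y :
  hdot (\sum_i f i) y = \sum_i hdot (f i) y :> R.
Proof.
by apply: (big_morph (fun x => hdot x y)) => [u v|]; rewrite ?hdotDl ?hdot0l.
Qed.

Lemma hdot_sumr n (f : 'I_n -> H) y :
  hdot y (\sum_i f i) = \sum_i hdot y (f i) :> R.
Proof. by rewrite hdotC hdot_suml; apply: eq_bigr => i _; rewrite hdotC. Qed.

Lemma bop_sumE n (f : 'I_n -> bop H) x : (\sum_i f i) x = \sum_i f i x.
Proof. exact: (big_morph (fun S : bop H => S x)). Qed.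

Lemma bopB T x y : T (x - y) = T x - T y.
Proof. by rewrite bopD -scaleN1r bopZ scaleN1r. Qed.

Lemma adjPr T x y : hdot x (adj T y) = hdot (T x) y :> R.
Proof. by rewrite hdotC adjP hdotC. Qed.

Lemma adj1 : adj (1 : bop H) = 1.
Proof. by symmetry; apply: adj_unique. Qed.

Lemma positive_op_ge0 X x : positive_op X -> 0 <= hdot (X x) x :> R.
Proof. by case=> S ->; rewrite bop_mulE adjP hdot_ge0. Qed.

(** * Square root of [1 - Z] for a symmetric contraction [Z] *)

Section SquareRoot.
Variable Z : bop H.
Hypothesis Zsym : forall x y, hdot (Z x) y = hdot x (Z y) :> R.
Hypothesis Zle : forall x, `|Z x| <= `|x|.

Let Y n : bop H := iter n (fun Y => (2^-1 : R) *: (Z + Y * Y)) 0.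
(* The iteration with [Z] replaced by [1] majorizes the one for [Z]. *)
Let c n : R := iter n (fun c => 2^-1 * (1 + c ^+ 2)) 0.

Let c_bounds n : 0 <= c n <= 1.
Proof. by elim: n => [|n /= /andP[]]; rewrite /= ?lexx ?ler01//; nra. Qed.

Let c_step n : c n <= c n.+1.
Proof. by have /andP[] := c_bounds n; rewrite [c n.+1]/= -/(c n); nra. Qed.

Let cE n : c n.+1 = 2^-1 * (1 + c n ^+ 2).
Proof. by []. Qed.

Let YE n x : Y n.+1 x = (2^-1 : R) *: (Z x + Y n (Y n x)).
Proof. by []. Qed.

Let Y_le n x : `|Y n x| <= c n * `|x|.
Proof.
elim: n x => [|n ih] x; first by rewrite normr0 mul0r.
have /andP[c0 c1] := c_bounds n.
rewrite YE normrZ ger0_norm ?invr_ge0// -mulrA ler_wpM2l ?invr_ge0//.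
rewrite mulrDl mul1r (le_trans (ler_normD _ _))// lerD//.
by rewrite (le_trans (ih _))// expr2 -mulrA ler_wpM2l.
Qed.

(** The splitting [P^2 - Q^2 = P (P - Q) + (P - Q) Q] holds without commutativity and applies to [Y]
    and [c] alike, so the bounds match term by term. *)
Let Y_step n x : `|Y n.+1 x - Y n x| <= (c n.+1 - c n) * `|x|.
Proof.
elim: n x => [|n ih] x.
  by rewrite subr0 subr0 Y_le.
have /andP[c0 c1] := c_bounds n; have /andP[d0 d1] := c_bounds n.+1.
have -> : Y n.+2 x - Y n.+1 x = (2^-1 : R) *:
    (Y n.+1 (Y n.+1 x - Y n x) + (Y n.+1 (Y n x) - Y n (Y n x))).
  rewrite bopB addrA subrK [Y n.+2 x]YE [X in _ - X]YE -scalerBr.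
  by rewrite opprD addrACA subrr add0r.
have -> : c n.+2 - c n.+1 = 2^-1 * (c n.+1 * (c n.+1 - c n) + (c n.+1 - c n) * c n).
  move: (c n.+2) (c n.+1) (c n) (cE n.+1) (cE n) => c2 c1' c0' -> e.
    by lra.
rewrite normrZ ger0_norm ?invr_ge0// -mulrA ler_wpM2l ?invr_ge0//.
rewrite mulrDl (le_trans (ler_normD _ _))// lerD//.
  by rewrite (le_trans (Y_le _ _))// -mulrA ler_wpM2l.
by rewrite (le_trans (ih _))// -mulrA ler_wpM2l ?Y_le// subr_ge0 c_step.
Qed.

Let Y_dist m n x : `|Y (m + n) x - Y m x| <= (c (m + n) - c m) * `|x|.
Proof.
elim: n => [|n ih]; first by rewrite addn0 !subrr normr0 mul0r.
rewrite addnS -(subrKA (Y (m + n) x)) (le_trans (ler_normD _ _))//.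
have -> : c (m + n).+1 - c m = c (m + n).+1 - c (m + n) + (c (m + n) - c m).
  by rewrite subrKA.
by rewrite mulrDl lerD// Y_step.
Qed.

Let Y_sym n x y : hdot (Y n x) y = hdot x (Y n y) :> R.
Proof.
elim: n x y => [|n ih] x y; first by rewrite hdot0l hdot0r.
by rewrite !YE hdotZl hdotZr hdotDl hdotDr Zsym !ih.
Qed.

Let l : R := sup (range c).

Let c_sup : has_sup (range c).
Proof.
by split; [exists (c 0), 0 | exists 1 => _ [n _ <-]; have /andP[] := c_bounds n].
Qed.

Let c_le_l n : c n <= l.
Proof. by apply: (ub_le_sup c_sup.2); exists n. Qed.

Let c_homo m n : (m <= n)%N -> c m <= c n.
Proof.
move=> /subnKC <-; elim: (n - m)%N => [|k ih]; first by rewrite addn0.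
by rewrite addnS (le_trans ih).
Qed.

Let c_small (e : R) : 0 < e -> exists N, forall n, (N <= n)%N -> l - c n < e.
Proof.
move=> e0; have [_ [N _ <-] hN] := sup_adherent e0 c_sup.
by exists N => n /c_homo h; rewrite -/l in hN; lra.
Qed.

(** Telescoping makes [Y n x] a Cauchy sequence, with the tails [l - c n] of the scalar iteration as
    rate, uniformly on the unit ball. *)
Let Y_lim : exists Y' : H -> H, forall x n, `|Y' x - Y n x| <= (l - c n) * `|x|.
Proof.
suff pointwise x : exists y, forall n, `|y - Y n x| <= (l - c n) * `|x|.
  by have [Y' hY'] := choice pointwise; exists Y'.
have small (e : R) : 0 < e -> exists N, forall n, (N <= n)%N -> (l - c n) * `|x| < e.
  move=> e0; have x1 : 0 < `|x| + 1 by rewrite ltr_wpDl.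
  have [N hN] := c_small (divr_gt0 e0 x1); exists N => n /hN.
  rewrite ltr_pdivlMr// mulrDr => h.
  by have := c_le_l n; lra.
have dist m n : (m <= n)%N -> `|Y n x - Y m x| <= (l - c m) * `|x|.
  move=> /subnKC <-; apply: le_trans (Y_dist _ _ _) _.
  by rewrite ler_wpM2r// lerD2r.
have : cvg ((fun n => Y n x) @ \oo).
  apply/cauchy_cvgP/cauchy_exP => e e0.
  have [N hN] := small e e0.
  exists (Y N x); exists N => // n /= Nn.
  by rewrite -ball_normE /= distrC (le_lt_trans (dist _ _ Nn))// hN.
move=> /cvg_ex[y /cvgrPdist_lt yY]; exists y => n.
apply/ler_addgt0Pr => e e0; have [N _ hN] := yY e e0.
rewrite -(subrKA (Y (maxn n N) x)) [leRHS]addrC.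
apply: le_trans (ler_normD _ _) (lerD _ (dist _ _ (leq_maxl n N))).
by apply/ltW/hN; rewrite /= leq_maxr.
Qed.

Lemma one_sub_positive_op : positive_op (1 - Z).
Proof.
have [Y' hY'] := Y_lim.
(* Each property of the limit is obtained by bounding its defect by a fixed multiple of [l - c n]
   for every [n]. *)
have small (p C : R) : (forall n, `|p| <= (l - c n) * C) -> p = 0.
  move=> h; apply/eqP; rewrite -normr_eq0 eq_le normr_ge0 andbT.
  apply/ler_addgt0Pr => e e0; rewrite add0r.
  have [C0|C0] := leP C 0.
    by rewrite (le_trans (h 0))// (le_trans _ (ltW e0))// mulr_ge0_le0// subr_ge0.
  have [N hN] := c_small (divr_gt0 e0 C0).
  by rewrite (le_trans (h N))// -ler_pdivlMr// ltW// hN.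
have small_vec (v : H) (C : R) : (forall n, `|v| <= (l - c n) * C) -> v = 0.
  by move=> h; apply/normr0_eq0/(small _ C) => n; rewrite normr_id.
have Y'l : linear Y'.
  move=> a x y; apply/subr0_eq.
  apply: (small_vec _ (`|a *: x + y| + `|a| * `|x| + `|y|)) => n.
  have -> : Y' (a *: x + y) - (a *: Y' x + Y' y) =
     (Y' (a *: x + y) - Y n (a *: x + y)) - a *: (Y' x - Y n x) - (Y' y - Y n y).
    apply: hdot_inj => w; rewrite bopD bopZ !(hdotDl, hdotNl, hdotZl).
    by ring.
  rewrite mulrDr mulrDr (le_trans (ler_normB _ _))// lerD//.
  rewrite (le_trans (ler_normB _ _))// lerD//.
  by rewrite normrZ mulrCA ler_wpM2l.
have Y'b : exists M : R, forall x, `|Y' x| <= M * `|x|.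
  by exists (l - c 0) => x; have := hY' x 0; rewrite subr0.
pose W : bop H := Bop Y'l Y'b.
have Wsym x y : hdot (W x) y = hdot x (W y) :> R.
  apply/subr0_eq/(small _ (2 * (`|x| * `|y|))) => n.
  have -> : hdot (W x) y - hdot x (W y) =
     hdot (W x - Y n x) y - hdot x (W y - Y n y) :> R.
    by rewrite hdotDl hdotDr hdotNl hdotNr Y_sym; ring.
  rewrite (le_trans (ler_normB _ _))// mulrCA mulrDl mul1r.
  rewrite lerD// (le_trans (hdot_le _ _))//.
    by rewrite mulrA ler_wpM2r// hY'.
  by rewrite mulrCA ler_wpM2l// hY'.
have Wfix x : (2 : R) *: W x = Z x + W (W x).
  apply/subr0_eq/(small_vec _ (2 * `|x| + `|W x| + `|x|)) => n.
  (* Subtracting the recursion for [Y n.+1 x] leaves only approximation errors. *)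
  have -> : (2 : R) *: W x - (Z x + W (W x)) =
     (2 : R) *: (W x - Y n.+1 x) - (W (W x) - Y n (W x)) - Y n (W x - Y n x).
    apply: hdot_inj => w; rewrite YE bopB !(hdotDl, hdotNl, hdotZl).
    by field.
  rewrite mulrDr mulrDr (le_trans (ler_normB _ _))// lerD//.
    rewrite (le_trans (ler_normB _ _))// lerD ?hY'//.
    rewrite normrZ ger0_norm// mulrCA ler_wpM2l// (le_trans (hY' _ _))//.
    by rewrite ler_wpM2r// lerD2l lerN2.
  rewrite (le_trans (Y_le _ _))// (le_trans _ (hY' x n))//.
  by rewrite ler_piMl//; have /andP[] := c_bounds n.
exists (1 - W); have <- : 1 - W = adj (1 - W).
  apply: adj_unique => x y; rewrite !bop_addE !bop_oppE !bop_oneE.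
  by rewrite hdotDl hdotDr hdotNl hdotNr Wsym.
apply: bopP => x; rewrite bop_mulE !bop_addE !bop_oppE !bop_oneE.
rewrite [W (x - W x)]bopB.
have -> : Z x = (2 : R) *: W x - W (W x) by rewrite Wfix addrK.
by rewrite (scalerDl _ 1 1) !scale1r !opprD !opprK !addrA.
Qed.

End SquareRoot.

(** For a bound [M] of [X], the form of [Z = 1 - X / (M + 1)] lies between 0 and that of the
    identity, so [Z] is a symmetric contraction. The factorization of [1 - Z] is then rescaled by
    the square root of [M + 1], which is positive even if [M = 0]. *)
Lemma positive_opP X :
  (forall x y, hdot (X x) y = hdot x (X y) :> R) ->
  (forall x, 0 <= hdot (X x) x :> R) -> positive_op X.
Proof.
move=> Xsym X0; have [M M0 hM] := bop_bound X.
have M1 : 0 < M + 1 by lra.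
have [Z ZE] : exists Z : bop H, forall x, Z x = x - (M + 1)^-1 *: X x.
  by exists (1 - (M + 1)^-1 *: X).
have Zsym x y : hdot (Z x) y = hdot x (Z y) :> R.
  by rewrite !ZE hdotDl hdotDr hdotNl hdotNr hdotZl hdotZr Xsym.
have Zform x : 0 <= hdot (Z x) x <= `|x| ^+ 2.
  rewrite ZE hdotDl hdotNl hdotZl hdotxx lerBlDr lerDl subr_ge0.
  rewrite mulr_ge0 ?invr_ge0 ?(ltW M1)// andbT ler_pdivrMl//.
  rewrite (le_trans (ler_norm _))// (le_trans (hdot_le _ _))//.
  rewrite expr2 mulrA ler_wpM2r// (le_trans (hM x))// ler_wpM2r//; lra.
have Zle x : `|Z x| <= `|x|.
  have /andP[p0 p1] := Zform x; have /andP[r0 r1] := Zform (Z x).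
  (* Cauchy-Schwarz for the semidefinite form of [Z], at [x] and [Z x]; with [Zform] it bounds
     [|Z x|^4] by [|x|^2 |Z x|^2]. *)
  have h : hdot (Z x) (Z x) ^+ 2 <= (hdot (Z x) x : R) * hdot (Z (Z x)) (Z x).
    apply: discriminant_le0 => // t.
    have /andP[+ _] := Zform (x + t *: Z x).
    rewrite bopD bopZ !hdotDl !hdotDr !hdotZl !hdotZr (Zsym (Z x) x).
    by congr (0 <= _); ring.
  have [->|Zx0] := eqVneq (Z x) 0; first by rewrite normr0.
  have n0 : 0 < `|Z x| ^+ 2 by rewrite exprn_gt0 ?normr_gt0.
  rewrite -(@ler_pXn2r _ 2%N) ?nnegrE// -(ler_pM2r n0).
  by rewrite -expr2 -(hdotxx (Z x)) (le_trans h)// ler_pM// hdotxx.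
have [S hS] := one_sub_positive_op Zsym Zle.
exists (Num.sqrt (M + 1) *: S).
have -> : adj (Num.sqrt (M + 1) *: S) = Num.sqrt (M + 1) *: adj S.
  by symmetry; apply: adj_unique => x y; rewrite !bop_scaleE hdotZl hdotZr adjP.
apply: bopP => x; rewrite bop_mulE !bop_scaleE bopZ scalerA -expr2.
rewrite sqr_sqrtr ?(ltW M1)// -bop_mulE -hS bop_addE bop_oppE ZE bop_oneE.
by rewrite subKr scalerA mulfV ?scale1r// gt_eqF.
Qed.


End Operators.

(* Schur's product theorem for Gram matrices: subtracting from every [u i] its
   component along [u ord0] splits off a square. *)
Lemma gram_product_ge0 (R : realType) (K H : realHilbertType R) n
    (u : 'I_n -> K) (v : 'I_n -> H) :
  0 <= \sum_i \sum_j (hdot (u j) (u i) : R) * hdot (v j) (v i).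
Proof.
elim: n u v => [|n ih] u v; first by rewrite big_ord0.
(* If [e = 0], division by zero gives [c i = 0], and [cE] still holds. *)
pose e := u ord0; pose c i : R := hdot (u i) e / hdot e e.
have cE i : c i * hdot e e = hdot (u i) e.
  have [e0|e0] := eqVneq (hdot e e : R) 0; last by rewrite /c divfK.
  by rewrite e0 mulr0 (hdot_eq0 e0) hdot0r.
pose w i := u i - c i *: e.
have we i : hdot (w i) e = 0 :> R by rewrite hdotDl hdotNl hdotZl cE subrr.
have w0 : w ord0 = 0.
  apply: hdot_eq0; have -> : hdot (w ord0) (w ord0) =
      hdot (w ord0) e - c ord0 * hdot (w ord0) e :> R.
    by rewrite -hdotZr -hdotNr -hdotDr.
  by rewrite we mulr0 subr0.
have uE i : u i = w i + c i *: e by rewrite subrK.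
clearbody w; clearbody c.
have -> : \sum_i \sum_j (hdot (u j) (u i) : R) * hdot (v j) (v i) =
    \sum_i \sum_j (hdot (w j) (w i) : R) * hdot (v j) (v i) +
    hdot e e * hdot (\sum_i c i *: v i) (\sum_i c i *: v i).
  rewrite hdot_sumr mulr_sumr -big_split; apply: eq_bigr => i _ /=.
  rewrite hdot_suml mulr_sumr -big_split; apply: eq_bigr => j _ /=.
  rewrite [u i]uE [u j]uE !(hdotDl, hdotDr, hdotZl, hdotZr) we (hdotC e) we.
  by ring.
apply: addr_ge0; last exact: mulr_ge0 (hdot_ge0 _) (hdot_ge0 _).
(* As [w ord0 = 0], the first row and column vanish and [n] vectors remain. *)
rewrite big_ord_recl big1 ?add0r => [|j _]; last by rewrite w0 hdot0r mul0r.
under eq_bigr => i _ do rewrite big_ord_recl w0 hdot0l mul0r add0r.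
exact: ih.
Qed.

(** * Functionals and bilinear forms controlled by a map with dense range *)

Section DenseRange.
Context {R : realType} {V : lmodType R} {K : realHilbertType R}.
Variable G : V -> K.
Hypothesis Glin : linear G.
Hypothesis Gdense : forall y (e : R), 0 < e -> exists a, `|y - G a| < e.
Implicit Types (a b : V) (x y : K).

Let GP c a b : G (c *: a + b) = c *: G a + G b.
Proof. exact: Glin. Qed.

Let G0 : G 0 = 0.
Proof. by apply: (addrI (G 0)); rewrite -{1}(scale1r (G 0)) -GP scaler0 !addr0. Qed.

Lemma dense_orthogonal y : (forall a, hdot (G a) y = 0 :> R) -> y = 0.
Proof.
move=> h; apply/eqP/negP => /negP y0.
have n0 : 0 < `|y| by rewrite normr_gt0.
have [a ha] := Gdense y n0.
have : `|y| ^+ 2 <= `|y - G a| * `|y|.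
  apply: le_trans (hdot_le _ _); apply: le_trans (ler_norm _).
  by rewrite hdotDl hdotNl h subr0 hdotxx.
by rewrite expr2 ler_pM2r// leNgt ha.
Qed.

Lemma dense_hdot_inj x y :
  (forall a, hdot (G a) x = hdot (G a) y :> R) -> x = y.
Proof.
move=> h; apply/subr0_eq/dense_orthogonal => a.
by rewrite hdotDr hdotNr h subrr.
Qed.

(** The bound makes [L] a [C]-Lipschitz function of [G a]. It extends to all of [K], density forces
    the extension to be linear, and the Riesz theorem applies. *)
Lemma dense_riesz (L : V -> R) (C : R) : 0 <= C -> linear_for *%R L ->
  (forall a, `|L a| <= C * `|G a|) ->
  exists w, (forall a, L a = hdot (G a) w) /\ `|w| <= C.
Proof.
move=> C0 Ll hL.
have LP c a b : L (c *: a + b) = c * L a + L b by exact: Ll.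
have LB a b : L (a - b) = L a - L b by rewrite addrC -scaleN1r LP mulN1r addrC.
have GB a b : G (a - b) = G a - G b by rewrite addrC -scaleN1r GP scaleN1r addrC.
have L0 : L 0 = 0.
  apply/normr0_eq0/eqP; rewrite eq_le normr_ge0 andbT.
  by rewrite (le_trans (hL 0))// G0 normr0 mulr0.
(* McShane's Lipschitz extension *)
have ext y : exists r : R, forall a, `|r - L a| <= C * `|y - G a|.
  pose E := range (fun a => L a - C * `|y - G a|).
  have sep a b : L a - C * `|y - G a| <= L b + C * `|y - G b|.
    have := le_trans (ler_norm _) (hL (a - b)); rewrite LB GB.
    have -> : G a - G b = (y - G b) - (y - G a) by rewrite opprB [RHS]addrC subrKA.
    have := ler_wpM2l C0 (ler_normB (y - G b) (y - G a)).
    by rewrite mulrDr; lra.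
  have Esup : has_sup E.
    split; first by exists (L 0 - C * `|y - G 0|), 0.
    by exists (L 0 + C * `|y - G 0|) => _ [a _ <-].
  exists (sup E) => a; rewrite ler_norml; apply/andP; split.
    rewrite lerBrDr addrC; apply: (ub_le_sup Esup.2); by exists a.
  rewrite lerBlDr addrC; apply: ge_sup; first exact: Esup.1.
  by move=> _ [b _ <-].
have [f hf] := choice ext.
have fl : linear_for *%R f.
  move=> c x y; apply/subr0_eq/normr0_eq0/eqP.
  rewrite eq_le normr_ge0 andbT; apply/ler_addgt0Pr => e e0; rewrite add0r.
  (* Errors [e / N] in [x] and [y] cost [C (|c| + 1) e / N] in the first term below and as much in
     the other two together; the final [+ 1] keeps [N] positive. *)
  pose N := 2 * C * (`|c| + 1) + 1.
  have c0 : 0 <= `|c| by [].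
  have N0 : 0 < N by rewrite ltr_wpDl// !mulr_ge0//; lra.
  have [a ha] := Gdense x (divr_gt0 e0 N0).
  have [b hb] := Gdense y (divr_gt0 e0 N0).
  have -> : f (c *: x + y) - (c * f x + f y) =
      (f (c *: x + y) - L (c *: a + b)) - c * (f x - L a) - (f y - L b).
    by rewrite LP; ring.
  have h1 := hf (c *: x + y) (c *: a + b).
  have : `|c *: x + y - G (c *: a + b)| <= `|c| * `|x - G a| + `|y - G b|.
    rewrite GP opprD addrACA -scalerBr -normrZ; exact: ler_normD.
  move=> /(ler_wpM2l C0) h2; have h3 := ler_wpM2l c0 (hf x a); have h4 := hf y b.
  have d0 : 0 <= e / N by rewrite ltW// divr_gt0.
  have h5 : C * (`|c| * `|x - G a| + `|y - G b|) <= C * ((`|c| + 1) * (e / N)).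
    by rewrite ler_wpM2l// mulrDl mul1r lerD ?(ltW hb)// ler_wpM2l// ltW.
  have eN : e = (e / N) * N by rewrite divfK// gt_eqF.
  apply: le_trans (ler_normB _ _) _; apply: le_trans (lerD (ler_normB _ _) (lexx _)) _.
  rewrite normrM; rewrite eN /N.
  move: (e / _) d0 h5 => d d0 h5.
  by lra.
have fG a : f (G a) = L a.
  apply/subr0_eq/normr0_eq0/eqP; rewrite eq_le normr_ge0 andbT.
  by have := hf (G a) a; rewrite subrr normr0 mulr0.
have fC y : `|f y| <= C * `|y| by have := hf y 0; rewrite G0 L0 !subr0.
have [w hw] := riesz fl (ex_intro _ C fC).
exists w; split=> [a|]; first by rewrite -fG hw.
have [->|w0] := eqVneq w 0; first by rewrite normr0.
have n0 : 0 < `|w| by rewrite normr_gt0.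
rewrite -(ler_pM2r n0) -expr2 -hdotxx -hw.
exact: le_trans (ler_norm _) (fC w).
Qed.

(** Riesz is used twice: [B a b = <G a, w b>] for fixed [b], then [<w b, y> = <G b, v y>] for fixed
    [y]. As [v] is defined on all of [K], its adjoint is the desired operator. *)
Lemma bounded_form_operator (B : V -> V -> R) (C : R) : 0 <= C ->
  (forall b, linear_for *%R (B^~ b)) -> (forall a, linear_for *%R (B a)) ->
  (forall a b, `|B a b| <= C * (`|G a| * `|G b|)) ->
  exists S : bop K, forall a b, B a b = hdot (G a) (S (G b)).
Proof.
move=> C0 Bl Br hB.
have repl b : exists w, (forall a, B a b = hdot (G a) w) /\ `|w| <= C * `|G b|.
  apply: dense_riesz => //; first by rewrite mulr_ge0.
  by move=> a; rewrite -mulrA (mulrC `|G b|).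
have [w hw] := choice repl.
have wl : linear w.
  move=> c a b; apply: dense_hdot_inj => d.
  by rewrite hdotDr hdotZr -!(hw _).1 Br.
have repr y : exists v,
    (forall b, hdot (w b) y = hdot (G b) v :> R) /\ `|v| <= C * `|y|.
  apply: dense_riesz; first by rewrite mulr_ge0.
    by move=> c a b; rewrite wl hdotDl hdotZl.
  move=> b; apply: le_trans (hdot_le _ _) _.
  by rewrite mulrAC ler_wpM2r// (hw b).2.
have [v hv] := choice repr.
have vl : linear v.
  move=> c x y; apply: dense_hdot_inj => d.
  by rewrite hdotDr hdotZr -!(hv _).1 hdotDr hdotZr.
have vb : exists M : R, forall x, `|v x| <= M * `|x|.
  by exists C => x; exact: (hv x).2.
exists (adj (Bop vl vb)) => a b.
by rewrite adjPr /= hdotC -(hv _).1 hdotC (hw b).1.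
Qed.

End DenseRange.

(** * The Cauchy-Schwarz inequality for completely positive maps *)

Section CompletelyPositive.
Context {R : realType} {A : realCstarAlgType R} {H : realHilbertType R}.
Implicit Types (Phi : A -> bop H) (a b : A) (h k : H).

Lemma star1 : star 1 = 1 :> A.
Proof. by rewrite -[LHS]mul1r -[X in X * _]starK -starM mul1r starK. Qed.

(** A rank-one operator. It allows positivity, which is stated with operator coefficients, to be
    tested on arbitrary vectors. *)
Lemma vector_operator (x u : H) : x != 0 -> exists T : bop H, T x = u.
Proof.
move=> x0; pose f y : H := (hdot y x / hdot x x : R) *: u.
have fl : linear f.
  by move=> c y y'; rewrite /f hdotDl hdotZl mulrDl scalerDl scalerA mulrA.
have fb : exists M : R, forall y, `|f y| <= M * `|y|.
  exists (`|x| * `|(hdot x x)^-1 : R| * `|u|) => y.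
  rewrite normrZ normrM.
  have -> : `|x| * `|(hdot x x)^-1 : R| * `|u| * `|y| =
      `|y| * `|x| * `|(hdot x x)^-1 : R| * `|u| by ring.
  by rewrite !ler_wpM2r// hdot_le.
exists (Bop fl fb); rewrite /= /f divff ?scale1r//.
by apply: contra_neq x0; exact: hdot_eq0.
Qed.

Lemma CP_ge0 Phi a h : CP Phi -> 0 <= hdot (Phi (star a * a) h) h :> R.
Proof.
case=> _ /(_ 1%N (fun=> a) (fun=> 1)) /(@positive_op_ge0 _ _ _ h) + _.
by rewrite !big_ord1 adj1 mul1r mulr1.
Qed.

(** Apply positivity to the family [a], [b] with operators sending one vector [x] to [h] and [k],
    and evaluate the form at [x]. The two cross terms agree because [Phi] commutes with the
    involutions. *)
Lemma CP_form_ge0 Phi a b h k : CP Phi ->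
  0 <= hdot (Phi (star a * a) h) h + hdot (Phi (star b * b) k) k +
       2 * hdot (Phi (star b * a) h) k :> R.
Proof.
case=> _ posPhi adjPhi.
(* In the zero space there is no such [x], but every term vanishes. *)
have [[x x0]|no] := pselect (exists x : H, x != 0); last first.
  have H0 (y : H) : y = 0 by apply/eqP/negP => /negP y0; apply: no; exists y.
  by rewrite (H0 h) (H0 k) !hdot0r mulr0 !addr0.
have [T Tx] := vector_operator h x0; have [S Sx] := vector_operator k x0.
pose c (i : 'I_2) := if i == ord0 then a else b.
pose B (i : 'I_2) := if i == ord0 then T else S.
have := @positive_op_ge0 _ _ _ x (posPhi 2 c B).
rewrite !big_ord_recl !big_ord0 !addr0 !bop_addE !bop_mulE.
rewrite (_ : c ord0 = a)// (_ : B ord0 = T)//.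
rewrite (_ : c (lift _ _) = b)// (_ : B (lift _ _) = S)//.
rewrite !hdotDl !adjP Tx Sx.
have -> : star a * b = star (star b * a) by rewrite starM starK.
rewrite adjPhi adjP (hdotC k).
by congr (0 <= _); ring.
Qed.

Lemma CP_cauchy_schwarz Phi a b h k : CP Phi ->
  (hdot (Phi (star b * a) h) k : R) ^+ 2 <=
    hdot (Phi (star a * a) h) h * hdot (Phi (star b * b) k) k.
Proof.
move=> cpPhi; rewrite mulrC; apply: discriminant_le0 => [|t].
  exact: CP_ge0.
have := CP_form_ge0 a b (t *: h) k cpPhi.
rewrite !bopZ !hdotZl !hdotZr.
by congr (0 <= _); ring.
Qed.

End CompletelyPositive.

(** * The GNS representation and maps dominated by [phi] *)

Section GNS.
Context {R : realType} {A : realCstarAlgType R} {H K : realHilbertType R}.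
Variables (phi : A -> R) (pi : A -> bop K) (z : K).
Hypothesis GNS : minimal_GNS phi pi z.
Implicit Types (a b : A) (x y : K).

Let pi_linear c a b : pi (c *: a + b) = c *: pi a + pi b.
Proof. by have [[pil _ _ _] _ _] := GNS; exact: pil. Qed.

Let piM a b : pi (a * b) = pi a * pi b.
Proof. by have [[_ pim _ _] _ _] := GNS. Qed.

Let pi1 : pi 1 = 1.
Proof. by have [[_ _ p1 _] _ _] := GNS. Qed.

Let pi_star a : pi (star a) = adj (pi a).
Proof. by have [[_ _ _ ps] _ _] := GNS. Qed.

Let phiE a : phi a = hdot (pi a z) z.
Proof. by have [] := GNS. Qed.

Lemma GNS_dot a b : phi (star a * b) = hdot (pi b z) (pi a z).
Proof. by rewrite phiE piM pi_star bop_mulE adjP. Qed.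

Lemma GNS_linear : linear (fun a => pi a z).
Proof. by move=> c a b; rewrite pi_linear. Qed.

Lemma GNS_dense x (e : R) : 0 < e -> exists a, `|x - pi a z| < e.
Proof.
move=> e0; have [_ _ dense] := GNS.
have : closure (lspan [set pi a z | a in setT]) x by rewrite dense.
move=> /(_ (ball x e)) []; first exact: nbhsx_ballx.
move=> y [ly]; rewrite -ball_normE /= => xy.
(* The orbit of [z] is itself a subspace, so its span adds nothing. *)
have [|_ [a _ <-]|a _ ay] := ly [set pi a z | a in setT].
- split.
    exists 0 => //; have := pi_linear (-1) 0 0.
    by rewrite scaler0 addr0 scaleN1r addNr => ->.
  by move=> c _ _ [a _ <-] [b _ <-]; exists (c *: a + b) => //; rewrite pi_linear.
- by exists a.
- by exists a; rewrite ay.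
Qed.

Lemma inflation_UCP : phi 1 = 1 -> (forall a, phi (star a) = phi a) ->
  UCP (inflation phi H).
Proof.
move=> phi1 phi_star; split; last by rewrite /inflation phi1 scale1r.
split=> [c a b|n a T|a]; last first.
- apply: adj_unique => x y.
  by rewrite !bop_scaleE !bop_oneE hdotZl hdotZr phi_star.
- set X := (X in positive_op X).
  (* On the diagonal this is the entrywise product of the Gram matrices of the vectors [pi (a i) z]
     and [T i x]. *)
  have XE (x y : H) : hdot (X x) y = \sum_i \sum_j
      (hdot (pi (a j) z) (pi (a i) z) : R) * hdot (T j x) (T i y).
    rewrite bop_sumE hdot_suml; apply: eq_bigr => i _.
    rewrite bop_sumE hdot_suml; apply: eq_bigr => j _.
    by rewrite !bop_mulE adjP bop_scaleE bop_oneE hdotZl GNS_dot.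
  apply: positive_opP => [x y|x]; last by rewrite XE gram_product_ge0.
  rewrite [RHS]hdotC !XE exchange_big; apply: eq_bigr => i _.
  by apply: eq_bigr => j _; rewrite hdotC (hdotC (T i x)).
- rewrite /inflation.
  have -> : phi (c *: a + b) = c * phi a + phi b.
    by rewrite !phiE pi_linear bop_addE bop_scaleE hdotDl hdotZl.
  by rewrite scalerDl scalerA.
Qed.

(** A Radon-Nikodym argument for the coefficient between [h] and [k]: domination provides an
    operator in the commutant, hence a scalar, whose value is read off at the unit. *)
Lemma dominated_CP_scalar (Phi : A -> bop H) (h k : H) (C D : R) :
  phi 1 = 1 -> real_type pi -> CP Phi -> 0 <= C -> 0 <= D ->
  (forall a, hdot (Phi (star a * a) h) h <= C ^+ 2 * phi (star a * a)) ->
  (forall a, hdot (Phi (star a * a) k) k <= D ^+ 2 * phi (star a * a)) ->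
  forall a, hdot (Phi a h) k = hdot (Phi 1 h) k * phi a.
Proof.
move=> phi1 real cpPhi C0 D0 hC hD.
have [Phi_linear _ _] := cpPhi.
pose B a b : R := hdot (Phi (star b * a) h) k.
have Bl b : linear_for *%R (B^~ b).
  move=> c a a'; rewrite /B mulrDr -scalerAr Phi_linear.
  by rewrite bop_addE bop_scaleE hdotDl hdotZl.
have Br a : linear_for *%R (B a).
  move=> c b b'; rewrite /B star_is_linear mulrDl -scalerAl Phi_linear.
  by rewrite bop_addE bop_scaleE hdotDl hdotZl.
have B_le a b : `|B a b| <= C * D * (`|pi a z| * `|pi b z|).
  rewrite -(@ler_pXn2r _ 2%N)// ?nnegrE ?mulr_ge0//.
  rewrite real_normK ?num_real// (le_trans (CP_cauchy_schwarz _ _ _ _ cpPhi))//.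
  have -> : (C * D * (`|pi a z| * `|pi b z|)) ^+ 2 =
      (C ^+ 2 * `|pi a z| ^+ 2) * (D ^+ 2 * `|pi b z| ^+ 2) by ring.
  by rewrite -!hdotxx -!GNS_dot ler_pM// CP_ge0.
have [S SE] := bounded_form_operator GNS_linear GNS_dense (mulr_ge0 C0 D0) Bl Br B_le.
have : commutant pi S.
  have ortho := dense_hdot_inj GNS_dense.
  move=> c.
  (* Both sides have coefficient [<Phi (b^* c^* a) h, k>] against [pi a z]: in [B], the factor [c]
     moves across as [star c]. *)
  have eqz b : (S * pi c) (pi b z) = (pi c * S) (pi b z).
    apply: ortho => a; rewrite !bop_mulE -(bop_mulE (pi c) (pi b)) -piM -SE.
    have -> : pi c = adj (pi (star c)) by rewrite -pi_star starK.
    by rewrite adjPr -bop_mulE -piM -SE /B starM mulrA.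
  (* Agreement on the dense orbit passes to all vectors through the adjoints, whose values are
     determined by their coefficients against the orbit. *)
  apply: bopP => x; apply: hdot_inj => y; rewrite -!adjPr; congr hdot.
  by apply: ortho => b; rewrite !adjPr eqz.
rewrite real => -[s _ sE] a.
have B1 b : B b 1 = s * phi b.
  by rewrite SE pi1 bop_oneE -sE bop_scaleE bop_oneE hdotZr -phiE.
have := B1 1; have := B1 a; rewrite /B star1 !mul1r => -> ->.
by rewrite phi1 mulr1.
Qed.

End GNS.

Theorem proposition3p12 (R : realType) (A : realCstarAlgType R)
    (H : realHilbertType R) (phi : A -> R)
    (K : realHilbertType R) (pi : A -> bop K) (z : K) :
  real_state phi -> pure_functional phi ->
  minimal_GNS phi pi z -> irreducible pi -> real_type pi ->
  Cstar_extreme (inflation phi H).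
Proof.
move=> [_ phi1 _ phi_star] _ GNS _ real; split; first exact: inflation_UCP GNS _ _.
move=> n T Phis ucp invT _ PhiE j; exists 1.
split; first by split; rewrite adj1 mulr1.
(* All summands of [<Phi (a^* a) h, h> = |h|^2 phi (a^* a)] are nonnegative, so each is at most the
   sum. *)
have dom a (h : H) :
    hdot (Phis j (star a * a) (T j h)) (T j h) <= `|h| ^+ 2 * phi (star a * a).
  have -> : `|h| ^+ 2 * phi (star a * a) =
      \sum_i hdot (Phis i (star a * a) (T i h)) (T i h).
    transitivity (hdot (inflation phi H (star a * a) h) h : R).
      by rewrite bop_scaleE bop_oneE hdotZl hdotxx mulrC.
    rewrite PhiE bop_sumE hdot_suml; apply: eq_bigr => i _.
    by rewrite !bop_mulE adjP.
  rewrite (bigD1 j)//= lerDl sumr_ge0// => i _.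
  by apply: CP_ge0; have [] := ucp i.
have [S [TS _]] := invT j; have [cpj Phij1] := ucp j.
move=> a; rewrite /Ad adj1 mul1r mulr1; apply: bopP => x; apply: hdot_inj => y.
rewrite bop_scaleE bop_oneE hdotZl.
(* Surjectivity of [T j] puts arbitrary vectors in the form to which [dom] applies. *)
have TSE u : u = T j (S u) by rewrite -bop_mulE TS.
rewrite (TSE x) (TSE y).
rewrite (dominated_CP_scalar GNS phi1 real cpj (normr_ge0 _) (normr_ge0 _)
  (dom^~ (S x)) (dom^~ (S y))).
by rewrite Phij1 mulrC.
Qed.
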